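(* Let $\overline{G}$ be an exotic coBUG. If a connected component $H$ of $\overline{G}$ is uniform, then $H$ is a star, i.e. $H$ is isomorphic to $K_{1,\ell}$ for some integer $\ell\ge 0$.
   Context: All graphs are finite, simple, undirected, with nonempty vertex set; $\overline{G}$ denotes the complement of $G$. For distinct vertices $v,w$ of a connected graph $G$, let $\sigma_{vw}$ be the number of shortest paths between $v$ and $w$, and $\sigma_{vw}(x)$ the number of those containing $x$ as an internal vertex (so $\sigma_{vw}(x)=0$ if $x\in\{v,w\}$). The betweenness of a vertex $x$ is $B_G(x)=\sum_{\{v,w\}\subseteq V(G)}\frac{\sigma_{vw}(x)}{\sigma_{vw}}$, the sum being over unordered pairs of distinct vertices. A betweenness-uniform graph (BUG) is a connected graph $G$ in which all vertices have the same betweenness; this common value is the betweenness of $G$. A low-betweenness BUG is a BUG with betweenness smaller than $1$. Stars are the graphs $K_{1,\ell}$ with $\ell\ge 0$ ($K_{1,0}$ is the single-vertex graph). An exotic BUG is a low-betweenness BUG whose complement is not a disjoint union of stars of the same size (i.e. there is no $\ell\ge0$ such that every connected component of the complement is isomorphic to $K_{1,\ell}$). An exotic coBUG is the complement $\overline{G}$ of an exotic BUG $G$. In a graph $H$, a vertex $v$ is close to an edge $e=xy$ if $v$ is adjacent to at least one endpoint of $e$ (in particular, $x$ and $y$ are close to $e$). $C_H(e)$ is the set of vertices close to $e$, and $C_H(v)$ is the set of edges close to $v$. $H$ is $(m,t)$-uniform if $|C_H(v)|=m$ for every vertex $v$ and $|C_H(e)|=t$ for every edge $e$; $H$ is uniform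 if it is $(m,t)$-uniform for some $m,t$. *)

(* Defs.v *)
From mathcomp Require Import all_boot all_order all_algebra.

Set Implicit Arguments.
Unset Strict Implicit.
Unset Printing Implicit Defensive.

Record sgraph := SGraph {
  vertex :> finType;
  adj : rel vertex;
  adj_sym : symmetric adj;
  adj_irrefl : irreflexive adj
}.

Definition iso (G H : sgraph) : Prop :=
  exists f : G -> H, bijective f /\ forall x y, adj (f x) (f y) = adj x y.

Section Complement.
Variable G : sgraph.

Definition co_adj : rel G := fun x y => (x != y) && ~~ adj x y.

Lemma co_adj_sym : symmetric co_adj.
Proof. by move=> x y; rewrite /co_adj eq_sym adj_sym. Qed.

Lemma co_adj_irrefl : irreflexive co_adj.
Proof. by move=> x; rewrite /co_adj eqxx. Qed.

Definition complement : sgraph := SGraph co_adj_sym co_adj_irrefl.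
End Complement.

Section Induced.
Variables (G : sgraph) (S : {set G}).

Definition induced_adj : rel {x : G | x \in S} := fun x y => adj (val x) (val y).

Lemma induced_adj_sym : symmetric induced_adj.
Proof. by move=> x y; exact: adj_sym. Qed.

Lemma induced_adj_irrefl : irreflexive induced_adj.
Proof. by move=> x; exact: adj_irrefl. Qed.

Definition induced : sgraph := SGraph induced_adj_sym induced_adj_irrefl.
End Induced.

Section CompleteBipartite.
Variables m n : nat.

Definition bip_adj : rel ('I_m + 'I_n)%type := fun x y =>
  match x, y with
  | inl _, inr _ | inr _, inl _ => true
  | _, _ => false
  end.

Lemma bip_adj_sym : symmetric bip_adj.
Proof. by case=> [i|i] [j|j]. Qed.

Lemma bip_adj_irrefl : irreflexive bip_adj.
Proof. by case. Qed.

Definition complete_bipartite : sgraph := SGraph bip_adj_sym bip_adj_irrefl.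
End CompleteBipartite.

Definition star (l : nat) : sgraph := complete_bipartite 1 l.

Definition connected (G : sgraph) : Prop :=
  0 < #|G| /\ forall x y : G, connect (@adj G) x y.

(* Vertex sets of the connected components. *)
Definition components (G : sgraph) : {set {set G}} :=
  equivalence_partition (connect (@adj G)) [set: G].

Section Betweenness.
Variable G : sgraph.

(* The paths with n edges from v to w; a path v, p_1, ..., p_n = w is encoded
   by the tuple p, that is, without its first vertex. *)
Definition paths (n : nat) (v w : G) : {set n.-tuple G} :=
  [set p : n.-tuple G |
    [&& path (@adj G) v p, last v p == w & uniq (v :: p)]].

(* A path has fewer than #|G| edges; the value is #|G| when w cannot be
   reached from v. *)
Definition dist (v w : G) : nat :=
  find (fun n => 0 < #|paths n v w|) (iota 0 #|G|).

Definition shortest_paths (v w : G) : {set (dist v w).-tuple G} :=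
  paths (dist v w) v w.

Definition sigma (v w : G) : nat := #|shortest_paths v w|.

Definition sigma_at (v w x : G) : nat :=
  #|[set p in shortest_paths v w | [&& x \in v :: p, x != v & x != w]]|.

(* Comparing ranks in the enumeration of G selects each unordered pair of
   distinct vertices exactly once; the summand is symmetric in v and w. *)
Definition betweenness (x : G) : rat :=
  (\sum_(v : G) \sum_(w : G | (enum_rank v < enum_rank w)%N)
     (sigma_at v w x)%:R / (sigma v w)%:R)%R.
End Betweenness.

Definition BUG (G : sgraph) : Prop :=
  connected G /\ forall x y : G, betweenness x = betweenness y.

Definition low_betweenness_BUG (G : sgraph) : Prop :=
  BUG G /\ forall x : G, (betweenness x < 1)%R.

Definition exotic_BUG (G : sgraph) : Prop :=
  low_betweenness_BUG G /\
  ~ exists l : nat, forall S : {set complement G},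
      S \in components (complement G) -> iso (induced S) (star l).

Definition exotic_coBUG (H : sgraph) : Prop :=
  exists2 G : sgraph, exotic_BUG G & H = complement G.

Section Uniform.
Variable H : sgraph.

Definition edges : {set {set H}} :=
  [set [set p.1; p.2] | p : H * H & adj p.1 p.2].

Definition close (v : H) (e : {set H}) : bool := [exists x in e, adj v x].

Definition close_vertices (e : {set H}) : {set H} := [set v | close v e].

Definition close_edges (v : H) : {set {set H}} := [set e in edges | close v e].

Definition mt_uniform (m t : nat) : Prop :=
  (forall v : H, #|close_edges v| = m) /\
  (forall e : {set H}, e \in edges -> #|close_vertices e| = t).

Definition uniform : Prop := exists m t : nat, mt_uniform m t.
End Uniform.

(* Main.v *)
Require Import Defs.
From mathcomp Require Import all_boot.
From mathcomp Require Import all_order all_algebra zify.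

(** Let [H] be the complement of a low-betweenness BUG [G] on [n] vertices.
    Summing the betweenness over all vertices gives the sum of
    [dist v w - 1] over all pairs, which is therefore less than [n]; a pair at
    distance at least 3, having no common neighbour in [G], would force it to
    be at least [n], so [G] has diameter
    at most 2, and [H] has fewer than [n] edges.  Consequently the edge [vw] of
    [H] contributes [1 / (n - c(vw))], with [c(vw)] the number of vertices
    close to it, to exactly the vertices that are not close to it, and the sum
    of these weights over the edges close to [x] does not depend on [x].

    Comparing this sum at a leaf and at its neighbour shows that a component
    with a leaf is a star, and all star components have the same number [l] of
    leaves, since [l / (n - l - 1)] is constant.  Let [S] be an
    [(m, t)]-uniform component that is not a star, so its degrees are at
    least 2 and [m = t + d] with [d >= 0].  As [H] has fewer than [n] edges, it
    has more than [d] star components, hence [(l + 1) d + t < n].  But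
    [l / (n - l - 1) = m / (n - t)] forces [n] to divide the positive number
    [(l + 1) d + t]. *)

Set Implicit Arguments.
Unset Strict Implicit.
Unset Printing Implicit Defensive.

Import Order.TTheory GRing.Theory Num.Theory.

(** * Shortest paths, distance and betweenness *)

Section ShortestPaths.
Variable G : sgraph.
Implicit Types v w x : G.

Lemma card_internal n v w (p : n.-tuple G) :
  v != w -> p \in paths n v w ->
  #|[set x | [&& x \in v :: p, x != v & x != w]]| = n.-1.
Proof.
move=> vw; rewrite inE => /and3P[_ /eqP lp up].
have wp : w \in (v :: p) by rewrite -lp mem_last.
have -> : [set x | [&& x \in v :: p, x != v & x != w]]
          = [set x in v :: p] :\ v :\ w.
  by apply/setP=> x; rewrite !inE; case: (x == v); case: (x == w); rewrite ?andbF ?andbT.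
have := cardsD1 v [set x in v :: p]; have := cardsD1 w ([set x in v :: p] :\ v).
rewrite (@cardsE _ (mem (v :: p))) (card_uniqP up) /= size_tuple !inE eqxx.
rewrite -in_cons wp eq_sym vw; lia.
Qed.

(** Loop removal leaves at most [#|G| - 1] edges, so the search in [dist] over [iota 0 #|G|]
    succeeds. *)
Lemma paths_dist v w : connect (@adj G) v w -> 0 < #|paths (dist v w) v w|.
Proof.
move=> /connectP[p pp ->]; case/shortenP: pp => q qp uq _.
set w' := last v q.
have sq : size q < #|G| by have := max_card (mem (v :: q)); rewrite (card_uniqP uq).
have hq : has (fun n => 0 < #|paths n v w'|) (iota 0 #|G|).
  apply/hasP; exists (size q); first by rewrite mem_iota.
  by apply/card_gt0P; exists (in_tuple q); rewrite inE qp uq eqxx.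
have := nth_find 0 hq; rewrite nth_iota ?add0n //.
by rewrite -[X in _ < X](size_iota 0) -has_find.
Qed.

Lemma dist_le n v w : 0 < #|paths n v w| -> dist v w <= n.
Proof.
move=> n0; rewrite leqNgt; apply/negP=> lt_n.
have nG : n < #|G|.
  by rewrite (leq_trans lt_n) // -[X in _ <= X](size_iota 0) find_size.
by have := before_find 0 lt_n; rewrite nth_iota // add0n n0.
Qed.

Lemma paths0_eq v w : 0 < #|paths 0 v w| -> v = w.
Proof.
by case/card_gt0P=> p; rewrite inE (tuple0 p) /= => /andP[/eqP].
Qed.

Lemma paths1_adj v w : 0 < #|paths 1 v w| -> adj v w.
Proof.
case/card_gt0P=> p; case/tupleP: p => x p; rewrite inE (tuple0 p) /= andbT.
by case/and3P=> vx /eqP <-.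
Qed.

Definition common v w : {set G} := [set x | adj x v && adj x w].

Lemma commonC v w : common v w = common w v.
Proof. by apply/setP=> x; rewrite !inE andbC. Qed.

Lemma paths2E v w : v != w -> paths 2 v w = [set [tuple x; w] | x in common v w].
Proof.
move=> vw; apply/setP=> p; apply/idP/imsetP => [|[x]].
  case/tupleP: p => x p; case/tupleP: p => y p; rewrite inE (tuple0 p) /= andbT.
  case/and3P=> /andP[vx xy] /eqP yw _; exists x; last first.
    by apply/val_inj; rewrite /= yw.
  by rewrite inE adj_sym vx -yw xy.
rewrite inE => /andP[xv xw] ->; rewrite inE /= adj_sym xv xw eqxx /= !inE.
rewrite (negPf vw) orbF andbT; apply/andP; split; apply/eqP => E.
  by move: xv; rewrite E adj_irrefl.
by move: xw; rewrite E adj_irrefl.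
Qed.

(** Double counting of the pairs of a shortest path and an internal vertex on it. *)
Lemma sum_sigma_at v w :
  v != w -> (\sum_x sigma_at v w x = sigma v w * (dist v w).-1)%N.
Proof.
move=> vw; rewrite /sigma_at /sigma.
under eq_bigr => x _ do rewrite -sum1dep_card big_mkcondr /=.
rewrite exchange_big /= -sum_nat_const; apply: eq_bigr => p pS.
by rewrite -big_mkcond /= sum1dep_card card_internal.
Qed.

Hypothesis Gconn : connected G.

Lemma sigma_gt0 v w : 0 < sigma v w.
Proof. by apply: paths_dist; case: Gconn. Qed.

Lemma dist_ge2 v w : co_adj v w -> 1 < dist v w.
Proof.
case/andP=> vw nvw; have := sigma_gt0 v w; rewrite /sigma /shortest_paths.
case: (dist v w) => [/paths0_eq E|[/paths1_adj E|//]].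
  by rewrite E eqxx in vw.
by rewrite E in nvw.
Qed.

Lemma dist_ge3 v w : co_adj v w -> common v w = set0 -> 2 < dist v w.
Proof.
move=> cvw c0; have vw : v != w by case/andP: cvw.
rewrite ltn_neqAle dist_ge2 // andbT; apply/eqP => E.
have := sigma_gt0 v w; rewrite /sigma /shortest_paths -E paths2E // c0.
by rewrite imset0 cards0.
Qed.

Lemma dist2 v w : co_adj v w -> common v w != set0 -> dist v w = 2.
Proof.
move=> cvw c0; have vw : v != w by case/andP: cvw.
apply/eqP; rewrite eqn_leq dist_ge2 // andbT dist_le // paths2E //.
by case/set0Pn: c0 => x xc; apply/card_gt0P; exists [tuple x; w]; apply: imset_f.
Qed.

Lemma pair_tuple_inj w : injective (fun x : G => [tuple x; w]).
Proof. by move=> x y /(congr1 val) /= [->]. Qed.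

Lemma sigma_dist2 v w :
  co_adj v w -> common v w != set0 -> sigma v w = #|common v w|.
Proof.
move=> cvw c0; have vw : v != w by case/andP: cvw.
rewrite /sigma /shortest_paths dist2 // paths2E // card_imset //.
exact: pair_tuple_inj.
Qed.

Lemma sigma_at_dist2 v w x :
  co_adj v w -> common v w != set0 -> sigma_at v w x = (x \in common v w).
Proof.
move=> cvw c0; have vw : v != w by case/andP: cvw.
rewrite /sigma_at /shortest_paths dist2 // paths2E //.
have xE y : y \in common v w ->
  [&& x \in v :: [tuple y; w], x != v & x != w] = (x == y).
  rewrite !inE => /andP[yv yw]; case: (x =P y) => [->|_].
    rewrite orbT /=; apply/andP; split; apply/eqP=> E.
      by rewrite E adj_irrefl in yv.
    by rewrite E adj_irrefl in yw.
  by case: (x == v); case: (x == w).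
case: (boolP (x \in common v w)) => xc.
  rewrite -[RHS](cards1 [tuple x; w]); apply: eq_card => p; rewrite !inE.
  apply/andP/eqP => [[/imsetP[y yc ->]]|->].
    by rewrite xE // => /eqP ->.
  by rewrite imset_f // xE.
apply/eqP; rewrite cards_eq0; apply/eqP/setP => p; rewrite !inE.
apply/negP => /andP[/imsetP[y yc ->]]; rewrite xE // => /eqP E.
by rewrite E yc in xc.
Qed.

Lemma sigma_at_adj v w x : adj v w -> sigma_at v w x = 0.
Proof.
move=> avw; have vw : v != w.
  by apply/eqP=> E; rewrite E adj_irrefl in avw.
have d1 : dist v w <= 1.
  apply: dist_le; apply/card_gt0P; exists [tuple w].
  by rewrite inE /= avw eqxx inE vw.
have /eqP := sum_sigma_at vw; have -> : (dist v w).-1 = 0 by lia.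
by rewrite muln0 sum_nat_eq0 => /forallP/(_ x)/eqP.
Qed.

Local Open Scope ring_scope.

(** [betweenness] takes each unordered pair once, by rank; symmetric sums over ordered pairs are
    easier to regroup, at the price of a factor 2. *)
Lemma sum_ordered_pairs (a : G -> G -> rat) :
  (forall v w, a v w = a w v) -> (forall v, a v v = 0) ->
  \sum_v \sum_w a v w =
  (\sum_v \sum_(w | (enum_rank v < enum_rank w)%N) a v w) *+ 2.
Proof.
move=> asym a0; rewrite mulr2n.
rewrite [X in _ = _ + X](exchange_big_dep predT) //= -big_split /=.
apply: eq_bigr => v _.
rewrite (bigID (fun w => (enum_rank v < enum_rank w)%N)) /=; congr (_ + _).
rewrite (bigD1 v) ?ltnn //= a0 add0r; apply: eq_big => // w.
by rewrite -leqNgt ltn_neqAle -(inj_eq (@enum_rank_inj G)) andbC; congr (_ && _).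
Qed.

Lemma sum_betweenness :
  \sum_(x : G) betweenness x =
  \sum_(v : G) \sum_(w | (enum_rank v < enum_rank w)%N) (dist v w).-1%:R.
Proof.
rewrite exchange_big; apply: eq_bigr => v _.
rewrite exchange_big; apply: eq_bigr => w lt_vw.
have vw : v != w by apply/eqP => E; rewrite E ltnn in lt_vw.
rewrite -mulr_suml -natr_sum sum_sigma_at // natrM mulrC mulKf //.
by rewrite pnatr_eq0 -lt0n sigma_gt0.
Qed.

(** * Low betweenness forces diameter at most 2 *)

Hypothesis low : forall x : G, betweenness x < 1.

(* A symmetric lower bound for [dist v w - 1]; using it avoids proving that
   [dist] is symmetric. *)
Definition excess v w : nat := co_adj v w + (co_adj v w && (common v w == set0)).

Lemma excessC v w : excess v w = excess w v.
Proof. by rewrite /excess commonC (@co_adj_sym G v w). Qed.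

Lemma excess_dist v w : (excess v w <= (dist v w).-1)%N.
Proof.
rewrite /excess; case: (boolP (co_adj v w)) => //= cvw.
case: eqP => [c0|_]; first by have := dist_ge3 cvw c0; lia.
by have := dist_ge2 cvw; lia.
Qed.

(** The total betweenness is below [#|G|] and, by [sum_betweenness], bounds the excess summed over
    unordered pairs; ordered pairs double both sides. *)
Lemma sum_excess : (\sum_(v : G) \sum_(w : G) excess v w < 2 * #|G|)%N.
Proof.
rewrite -(ltr_nat rat) natr_sum.
under eq_bigr => v _ do rewrite natr_sum.
rewrite sum_ordered_pairs; last 2 first.
- by move=> v w; rewrite excessC.
- by move=> v; rewrite /excess (@co_adj_irrefl G v).
rewrite mul2n -muln2 natrM mulr_natr ltr_pMn2r //.
apply: (@le_lt_trans _ _ (\sum_(x : G) betweenness x)).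
  rewrite sum_betweenness; apply: ler_sum => v _; apply: ler_sum => w _.
  by rewrite ler_nat excess_dist.
have -> : #|G|%:R = \sum_(x : G) 1 :> rat by rewrite sumr_const.
case: Gconn => /card_gt0P[x0 _] _.
apply: ltr_sum => [|x _]; first by apply/hasP; exists x0 => //; exact: mem_index_enum.
  exact: low.
Qed.

(** Without a common neighbour, every vertex is adjacent in the complement to [v] or [w]. So [v] and
    [w] together have excess at least [#|G| + 2], the pair itself counting twice at each end, and
    each of the other [#|G| - 2] vertices has excess at least 1. The total [2 * #|G|] contradicts
    [sum_excess]. *)
Lemma common_neq0 v w : co_adj v w -> common v w != set0.
Proof.
move=> cvw; apply/negP => c0; have vw : v != w by case/andP: cvw.
have cwv : co_adj w v by rewrite (@co_adj_sym G).
have c0' : common w v == set0 by rewrite commonC.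
have deg_sum x : (\sum_y excess x y =
   #|[set y | co_adj x y]| + #|[set y | co_adj x y && (common x y == set0)]|)%N.
  rewrite big_split /= -!sum1dep_card.
  by congr (_ + _)%N; rewrite [RHS]big_mkcond.
have close_vw : forall z, co_adj v z || co_adj w z.
  move=> z; apply/negPn/negP; rewrite negb_or /co_adj !negb_and !negbK.
  case: (v =P z) => [<-|_]; first by rewrite [w == v]eq_sym (negPf vw) adj_sym /=;
    move: cvw => /andP[_ /negPf ->].
  case: (w =P z) => [<-|_ /= /andP[vz wz]]; first by rewrite andbT;
    move: cvw => /andP[_ /negPf ->].
  by move/eqP/setP/(_ z): c0; rewrite !inE ![adj z _]adj_sym vz wz.
have Dvw : (#|G| <= #|[set y | co_adj v y]| + #|[set y | co_adj w y]|)%N.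
  rewrite -cardsUI; apply: leq_trans (leq_addr _ _); rewrite -cardsT.
  by apply/subset_leq_card/subsetP=> z _; rewrite !inE close_vw.
have Ev : (0 < #|[set y | co_adj v y && (common v y == set0)]|)%N.
  by apply/card_gt0P; exists w; rewrite inE cvw.
have Ew : (0 < #|[set y | co_adj w y && (common w y == set0)]|)%N.
  by apply/card_gt0P; exists v; rewrite inE cwv.
have : (#|G| - 2 <= \sum_(z : G | (z != v) && (z != w)) \sum_y excess z y)%N.
  apply: (@leq_trans (\sum_(z : G | (z != v) && (z != w)) 1)%N).
    have -> : 2%N = #|[set v; w]| by rewrite cards2 vw.
    rewrite sum1dep_card -(cardsC [set v; w]) addKn.
    by apply/subset_leq_card/subsetP=> z; rewrite !inE negb_or.
  apply: leq_sum => z _; rewrite deg_sum; apply: leq_trans (leq_addr _ _).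
  apply/card_gt0P; case/orP: (close_vw z) => h; [exists v|exists w];
    by rewrite inE (@co_adj_sym G).
have := sum_excess; rewrite (bigD1 v) //= deg_sum (bigD1 w) 1?eq_sym //= deg_sum.
move: (#|G|) Dvw; lia.
Qed.

(** Only pairs at distance 2 contribute: adjacent pairs have no internal vertices, and [common_neq0]
    excludes larger distances. *)
Lemma double_betweenness x :
  betweenness x *+ 2 = \sum_v \sum_(w | co_adj v w && (x \in common v w))
     (#|common v w|%:R)^-1.
Proof.
pose a v w : rat :=
  if co_adj v w && (x \in common v w) then (#|common v w|%:R)^-1 else 0.
have -> : betweenness x = \sum_v \sum_(w | (enum_rank v < enum_rank w)%N) a v w.
  apply: eq_bigr => v _; apply: eq_bigr => w lt_vw; rewrite /a.
  have vw : v != w by apply/eqP => E; rewrite E ltnn in lt_vw.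
  case: (boolP (co_adj v w)) => [cvw|].
    rewrite sigma_at_dist2 ?common_neq0 // sigma_dist2 ?common_neq0 //=.
    by case: (x \in _); rewrite ?mul1r ?mul0r.
  by rewrite /co_adj vw /= negbK => avw; rewrite sigma_at_adj // mul0r.
rewrite -sum_ordered_pairs.
- by apply: eq_bigr => v _; rewrite [RHS]big_mkcond.
- by move=> v w; rewrite /a commonC (@co_adj_sym G v w).
- by move=> v; rewrite /a (@co_adj_irrefl G v).
Qed.

End ShortestPaths.

(** * Closeness in terms of arcs, and its restriction to a component *)

Section Arcs.
Variable H : sgraph.
Implicit Types (v w x : H) (S : {set H}).

Definition nbrs v : {set H} := [set w | adj v w].

Definition clo v w : {set H} := [set x | adj x v || adj x w].

(* Edges are represented by ordered pairs, hence each one is counted twice. *)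
Definition arcs_near x : {set H * H} :=
  [set p | adj p.1 p.2 && (x \in clo p.1 p.2)].

Lemma sum_deg (A : {set H}) :
  \sum_(v in A) #|nbrs v| = #|[set p : H * H | (p.1 \in A) && adj p.1 p.2]|.
Proof.
rewrite -sum1dep_card -(pair_big_dep (mem A) (fun a b => adj a b) (fun _ _ => 1)) /=.
by apply: eq_bigr => v _; rewrite sum1dep_card.
Qed.

Lemma close_set2 x v w : close x [set v; w] = (x \in clo v w).
Proof.
rewrite inE; apply/existsP/orP => [[y /andP[]]|[h|h]].
- by rewrite !inE => /orP[]/eqP ->; [left|right].
- by exists v; rewrite !inE eqxx.
- by exists w; rewrite !inE eqxx orbT.
Qed.

Lemma card_close_vertices v w : #|close_vertices [set v; w]| = #|clo v w|.
Proof. by apply: eq_card => x; rewrite [LHS]inE close_set2. Qed.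

Lemma card_arcs_near x : #|arcs_near x| = #|close_edges x| * 2.
Proof.
pose h (p : H * H) := [set p.1; p.2].
rewrite -sum1_card (partition_big h (mem (close_edges x))) /=; last first.
  move=> [a b]; rewrite inE -close_set2 /= => /andP[ab cl].
  rewrite !inE cl andbT.
  by apply/imsetP; exists (a, b); rewrite ?inE.
rewrite -sum_nat_const; apply: eq_bigr => e; rewrite inE => /andP[/imsetP[[a b]]].
rewrite inE /= => ab -> cl; rewrite sum1dep_card.
have neq : a != b by apply/eqP => E; rewrite E adj_irrefl in ab.
have -> : 2 = #|[set (a, b); (b, a)]|.
  by rewrite cards2 xpair_eqE negb_and neq.
apply: eq_card => -[c d]; rewrite !inE /h /= !xpair_eqE.
apply/andP/orP => [[/andP[cd _] /eqP/setP E]|].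
  have cd' : c != d by apply/eqP => E'; rewrite E' adj_irrefl in cd.
  have := E c; have := E d; rewrite !inE !eqxx ?orbT => /esym hd /esym hc.
  case/orP: hc => /eqP ec; case/orP: hd => /eqP ed; subst.
  - by rewrite eqxx in cd'.
  - by left; rewrite !eqxx.
  - by right; rewrite !eqxx.
  - by rewrite eqxx in cd'.
move: cl; rewrite close_set2 inE => cl.
case=> /andP[/eqP-> /eqP->]; first by rewrite ab cl.
by rewrite adj_sym ab orbC cl setUC.
Qed.

(** Such sets are the unions of connected components. *)
Definition component_closed S := forall x y, x \in S -> adj x y -> y \in S.

End Arcs.

(** A vertex close to an arc inside a closed set lies in that set, so restriction loses nothing. *)
Lemma card_clo_induced (H : sgraph) (S : {set H}) (a b : induced S) :
  component_closed S -> #|clo (val a) (val b)| = #|clo a b|.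
Proof.
move=> Scl; rewrite -(card_imset _ val_inj); apply: eq_card => x.
apply/idP/imsetP => [|[y]]; last by rewrite !inE => h ->.
rewrite inE => h; have xS : x \in S.
  by case/orP: h; rewrite adj_sym; apply: Scl; exact: valP.
by exists (Sub x xS); rewrite ?inE.
Qed.

Lemma card_arcs_near_induced (H : sgraph) (S : {set H}) (x : induced S) :
  component_closed S -> #|arcs_near (val x)| = #|arcs_near x|.
Proof.
move=> Scl; pose h (p : induced S * induced S) := (val p.1, val p.2).
have hinj : injective h by move=> [a b] [c d] [/val_inj -> /val_inj ->].
rewrite -(card_imset _ hinj); apply: eq_card => -[a b].
apply/idP/imsetP => [|[[c d]]]; last by rewrite !inE => k [-> ->].
rewrite !inE /= => /andP[ab k].
have [aS bS] : a \in S /\ b \in S.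
  case/orP: k => k; have kS := Scl _ _ (valP x) k; split=> //.
    exact: Scl kS ab.
  by apply: Scl kS _; rewrite adj_sym.
by exists (Sub a aS, Sub b bS); rewrite // !inE /= /induced_adj ab.
Qed.

(** Moves uniformity to the ambient graph, where the loads live; the factor 2 stands for the two
    orientations of an edge. *)
Lemma uniform_component (H : sgraph) (S : {set H}) :
  component_closed S -> uniform (induced S) ->
  exists m t : nat, (forall x, x \in S -> #|arcs_near x| = m * 2) /\
    (forall v w, v \in S -> adj v w -> #|clo v w| = t).
Proof.
move=> Scl [m [t [hm ht]]]; exists m, t; split => [x xS|v w vS vw].
  by rewrite -[x]/(val (Sub x xS : induced S)) card_arcs_near_induced // card_arcs_near hm.
have wS := Scl _ _ vS vw.
rewrite -[v]/(val (Sub v vS : induced S)) -[w]/(val (Sub w wS : induced S)).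
rewrite card_clo_induced // -card_close_vertices; apply: ht.
by apply/imsetP; exists (Sub v vS, Sub w wS); rewrite // inE.
Qed.

(* [n] is the order of the graph and [s] its number of star components; [N] and
   [D] are the order and the degree sum of the non-star component. *)
Lemma component_arith (n N D s l m t : nat) :
  0 < t -> t <= N -> 2 * N <= D -> N * (m * 2) = D * t -> D < 2 * N + 2 * s ->
  l.+1 * s + N <= n -> l * (n - t) = m * (n - l.+1) -> False.
Proof.
move=> t0 tN DN Dm Ds sn E.
have s0 : 0 < s by lia.
have tm : t <= m.
  have : N * 2 * t <= N * 2 * m by nia.
  by rewrite leq_pmul2l //; lia.
have [d dE] : exists d, m = t + d by exists (m - t); lia.
subst m.
(* From [N * (2 * d) = (D - 2 * N) * t], with [D - 2 * N < 2 * s] and [t <= N]. *)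
have ds : d < s by nia.
have ls : l.+1 <= l.+1 * s by nia.
have [k kE] : exists k, n = l.+1 + t + k by exists (n - (l.+1 + t)); lia.
have E2 : l * (l.+1 + k) = (t + d) * (t + k).
  have e1 : n - t = l.+1 + k by clear -kE; lia.
  have e2 : n - l.+1 = t + k by clear -kE; lia.
  by move: E; rewrite e1 e2.
have ld : l.+1 * d + l.+1 <= l.+1 * s by rewrite -mulnSr leq_mul2l ds orbT.
(* Hence [n] divides [l.+1 * d + t], which is positive by [t0] and less than [n] by [small]; [lt]
   and [big] express the contradiction without subtraction. *)
have key : l.+1 * d + t + n * l = n * (t + d) by clear -E2 kE; subst n; nia.
have small : l.+1 * d + t < n by clear -ld sn tN; lia.
have lt : n * l < n * (t + d) by rewrite -key; clear -t0; lia.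
have big : n * l.+1 <= n * (t + d).
  by rewrite leq_mul2l; apply/orP; right; move: lt; rewrite ltn_mul2l => /andP[].
rewrite mulnS in big; clear -big small key; lia.
Qed.

(** * Constant load and the star components *)

Section Core.
Variable H : sgraph.
Implicit Types v w x : H.

Local Open Scope ring_scope.

(** In a coBUG the vertices not close to an edge are the common neighbours of its ends in the
    original graph, so this is the inverse of the number of shortest paths between them. *)
Definition weight (p : H * H) : rat := (#|~: clo p.1 p.2|%:R)^-1.

Definition load x : rat := \sum_(p in arcs_near x) weight p.

Hypothesis clo_proper : forall v w, adj v w -> (0 < #|~: clo v w|)%N.
Hypothesis load_const : forall x y, load x = load y.
Hypothesis few_edges : (\sum_(v : H) #|nbrs v| < 2 * #|H|)%N.

Lemma weight_gt0 p : adj p.1 p.2 -> 0 < weight p.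
Proof. by move=> /clo_proper h; rewrite invr_gt0 ltr0n. Qed.

(** Weights are positive, so nested sets of arcs with the same total weight coincide. *)
Lemma arcs_near_subset x y :
  arcs_near x \subset arcs_near y -> arcs_near x = arcs_near y.
Proof.
move=> sub; apply/eqP; rewrite eqEsubset sub /=; apply/subsetP => p py.
apply/negPn/negP => px.
have := load_const y x; rewrite /load (big_setID (arcs_near x)) /=.
rewrite (setIidPr sub) -[RHS]addr0 => /addrI /eqP.
have pos q : q \in arcs_near y :\: arcs_near x -> 0 < weight q.
  by rewrite !inE => /andP[_ /andP[h _]]; exact: weight_gt0.
rewrite psumr_eq0 => [|q /pos /ltW //] => /allP /(_ p (mem_index_enum p)).
have pin : p \in arcs_near y :\: arcs_near x by rewrite inE px.
by rewrite pin /= gt_eqF // pos.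
Qed.

(* An isolated vertex is a center, and so are both ends of a [K_{1,1}]. *)
Definition center v := forall z, adj v z -> nbrs z = [set v].

(** Every edge close to the leaf [u] contains [v], hence is close to [v]. By [arcs_near_subset] the
    converse holds too, so an edge from a neighbour [z] of [v] can only end at [v]. *)
Lemma leaf_center u v : nbrs u = [set v] -> center v.
Proof.
move=> uv z vz; apply/setP => y; rewrite !inE; apply/idP/eqP => [zy|->]; last by rewrite adj_sym.
have nu y' : adj u y' = (y' == v) by have /setP/(_ y') := uv; rewrite !inE.
have sub : arcs_near u \subset arcs_near v.
  apply/subsetP => -[a b]; rewrite !inE /= !nu => /andP[ab]; rewrite ab /=.
  by case/orP=> /eqP E; rewrite -E ?ab ?orbT // [adj b a]adj_sym ab.
have /setP/(_ (z, y)) := arcs_near_subset sub; rewrite !inE /= zy vz !nu /=.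
by case/orP=> /eqP // E; rewrite E adj_irrefl in vz.
Qed.

Lemma low_degree_center u :
  (#|nbrs u| <= 1)%N -> exists2 v, center v & u \in v |: nbrs v.
Proof.
rewrite leq_eqVlt => /orP[/cards1P[v uv]|].
  exists v; first exact: leaf_center uv.
  by rewrite !inE adj_sym -[adj u v]in_set -/(nbrs u) uv set11 orbT.
rewrite ltnS leqn0 cards_eq0 => /eqP u0; exists u; last by rewrite !inE eqxx.
by move=> z uz; have /setP/(_ z) := u0; rewrite !inE uz.
Qed.

Section Center.
Variable v : H.
Hypothesis vc : center v.

Lemma center_clo z : adj v z -> clo v z = v |: nbrs v.
Proof.
move=> vz; apply/setP=> x; rewrite !inE ![adj x _]adj_sym orbC.
by have /setP/(_ x) := vc vz; rewrite !inE => ->.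
Qed.

Lemma card_star : #|v |: nbrs v| = #|nbrs v|.+1.
Proof. by rewrite cardsU1 inE adj_irrefl. Qed.

Lemma star_closed : component_closed (v |: nbrs v).
Proof.
move=> x y; rewrite !inE => /orP[/eqP->->|vx xy]; first by rewrite orbT.
by have /setP/(_ y) := vc vx; rewrite !inE xy => <-.
Qed.

Lemma star_sum_deg : (\sum_(a in v |: nbrs v) #|nbrs a| = 2 * #|nbrs v|)%N.
Proof.
rewrite big_setU1 ?inE ?adj_irrefl //= mul2n -addnn; congr addn.
rewrite -sum1_card; apply: eq_bigr => z; rewrite inE => /vc ->.
by rewrite cards1.
Qed.

Lemma star_arcs_near : arcs_near v = [set p | (p.1 \in v |: nbrs v) && adj p.1 p.2].
Proof.
apply/setP => -[a b]; rewrite !inE /=; case: (boolP (adj a b)) => ab; rewrite ?andbF //= andbT.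
apply/orP/orP => [[h|h]|[/eqP E|h]]; [by right| |by rewrite -E; right|by left].
have /setP/(_ a) := vc h; rewrite !inE adj_sym ab => /esym ->; by left.
Qed.

(** All [2 * #|nbrs v|] arcs of the star are close to its center, and the vertices close to any one
    of them form the whole star. *)
Lemma star_load : load v = (2 * #|nbrs v|)%:R / (#|H| - #|nbrs v|.+1)%:R.
Proof.
rewrite -star_sum_deg sum_deg -star_arcs_near mulr_natl /load -sumr_const.
apply: eq_bigr => -[a b]; rewrite star_arcs_near !inE /weight /= => /andP[h ab].
congr (_%:R^-1); rewrite -card_star -[#|H|](cardsC (clo a b)).
suff -> : clo a b = v |: nbrs v by rewrite addKn.
case/orP: h ab => [/eqP -> |va ab]; first exact: center_clo.
have /setP/(_ b) := vc va; rewrite !inE ab => /esym/eqP ->.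
by rewrite -(center_clo va); apply/setP=> x; rewrite !inE orbC.
Qed.

End Center.

End Core.

Local Open Scope nat_scope.

(** * Connected components *)

Section Components.
Variables (H : sgraph) (S : {set H}).
Hypothesis SH : S \in components H.

Lemma mem_componentE x : x \in S -> S = [set y | connect (@adj H) x y].
Proof.
have csym := @sym_connect_sym _ (@adj H) (@adj_sym H).
case/imsetP: SH => x0 _ ->; rewrite !inE /= => x0x.
by apply/setP => y; rewrite !inE /= (same_connect csym x0x).
Qed.

Lemma component_neq0 : exists x, x \in S.
Proof. by case/imsetP: SH => x0 _ ->; exists x0; rewrite !inE connect0. Qed.

Lemma component_is_closed : component_closed S.
Proof.
by move=> x y xS xy; rewrite (mem_componentE xS) inE connect1.
Qed.

Lemma component_min (A : {set H}) x :
  component_closed A -> x \in S -> x \in A -> S \subset A.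
Proof.
move=> Acl xS xA; rewrite (mem_componentE xS); apply/subsetP => y.
rewrite inE => /connectP[p]; elim: p x xA {xS} => [|z p IHp] x xA /= => [_ ->//|].
by case/andP=> xz; apply: IHp; apply: Acl xz.
Qed.

Lemma component_star v x : center v -> x \in S -> x \in v |: nbrs v ->
  S = v |: nbrs v.
Proof.
move=> vc xS xv; apply/eqP; rewrite eqEsubset.
rewrite (component_min (star_closed vc) xS xv) /=.
have vS : v \in S.
  move: xv; rewrite !inE => /orP[/eqP <- //|vx].
  by apply: component_is_closed xS _; rewrite adj_sym.
apply/subsetP => y; rewrite !inE => /orP[/eqP -> //|].
exact: component_is_closed.
Qed.

End Components.

Lemma components_partition (H : sgraph) : partition (components H) [set: H].
Proof.
apply: equivalence_partitionP => x y z _ _ _; split=> // xy.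
exact: same_connect (@sym_connect_sym _ (@adj H) (@adj_sym H)) _ _ xy z.
Qed.

Lemma star_iso (H : sgraph) (v : H) :
  center v -> iso (induced (v |: nbrs v)) (star #|nbrs v|).
Proof.
move=> vc; set S := v |: nbrs v.
(* The index of the center among its neighbours is out of range, so [insub] fails exactly there. *)
pose f (x : induced S) : star #|nbrs v| :=
  if insub (index (val x) (enum (nbrs v))) is Some i then inr i else inl ord0.
have ivN x : (index x (enum (nbrs v)) < #|nbrs v|) = adj v x.
  by rewrite cardE index_mem mem_enum inE.
have fE (x : induced S) : if adj v (val x) then
    exists2 i : 'I_#|nbrs v|, f x = inr i & val i = index (val x) (enum (nbrs v))
    else f x = inl ord0.
  rewrite /f; case: insubP => [i|]; rewrite ivN; last by move/negPf ->.
  by move=> -> <-; exists i.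
have vE (x : induced S) : adj v (val x) = false -> val x = v.
  by move=> h; have := valP x; rewrite !inE h orbF => /eqP.
exists f; split => [|x y]; last first.
  rewrite -[RHS]/(adj (val x) (val y)); have := fE x; have := fE y.
  case vx: (adj v (val x)); case vy: (adj v (val y)).
  - move=> [i -> _] [j -> _] /=.
    have /setP/(_ (val y)) := vc _ vx; rewrite !inE => ->.
    by apply/esym/eqP => E; rewrite E adj_irrefl in vy.
  - by move=> -> [j -> _] /=; rewrite (vE _ vy) adj_sym vx.
  - by move=> [j -> _] -> /=; rewrite (vE _ vx) vy.
  - by move=> -> -> /=; rewrite (vE _ vx) vy.
apply: inj_card_bij.
  move=> x y fxy; have := fE x; have := fE y; rewrite fxy.
  case vx: (adj v (val x)); case vy: (adj v (val y)).
  - move=> [i -> hi] [j [<-]]; rewrite hi => /esym E; apply: val_inj.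
    by apply: (index_inj v _ _ E); rewrite mem_enum inE.
  - by move=> -> [].
  - by move=> [i ->].
  - by move=> _ _; apply: val_inj; rewrite (vE _ vx) (vE _ vy).
by rewrite card_sum !card_ord card_sig card_star.
Qed.

(** * A uniform component with all degrees at least 2 is impossible *)

Section UniformComponent.
Variable H : sgraph.
Hypothesis clo_proper : forall v w : H, adj v w -> 0 < #|~: clo v w|.
Hypothesis load_const : forall x y : H, load x = load y.
Hypothesis few_edges : \sum_(v : H) #|nbrs v| < 2 * #|H|.

(** The average degree is below 2. *)
Lemma exists_low_degree : exists u : H, #|nbrs u| <= 1.
Proof.
case: (boolP [exists u : H, #|nbrs u| <= 1]) => [/existsP //|].
rewrite negb_exists => /forallP big.
move: few_edges; rewrite ltnNge mulnC -sum_nat_const leq_sum // => v _.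
by rewrite ltnNge big.
Qed.

Variable S : {set H}.
Hypothesis SH : S \in components H.
Variables m t : nat.
Hypothesis arcsS : forall x, x \in S -> #|arcs_near x| = m * 2.
Hypothesis cloS : forall v w, v \in S -> adj v w -> #|clo v w| = t.
Hypothesis degS : forall x, x \in S -> 1 < #|nbrs x|.

Lemma S_degree_sum : 2 * #|S| <= \sum_(v in S) #|nbrs v|.
Proof. by rewrite mulnC -sum_nat_const leq_sum. Qed.

(** Double counting of the pairs of a vertex of [S] and an arc close to it; closeness never leaves
    [S]. *)
Lemma S_double_count : #|S| * (m * 2) = (\sum_(v in S) #|nbrs v|) * t.
Proof.
have Scl := component_is_closed SH.
rewrite sum_deg -!sum_nat_const -(eq_bigr _ arcsS).
under eq_bigr => x _ do rewrite -sum1dep_card.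
rewrite (exchange_big_dep (fun p : H * H => (p.1 \in S) && adj p.1 p.2)) /=.
  apply: eq_big => [p|[a b]]; first by rewrite inE.
  case/andP=> aS ab; rewrite -(cloS aS ab) -sum1_card; apply: eq_bigl => x /=.
  rewrite ab /=; apply: andb_idl; rewrite inE => /orP[] h.
    by apply: Scl aS _; rewrite adj_sym.
  by apply: Scl (Scl _ _ aS ab) _; rewrite adj_sym.
move=> x [a b] xS /andP[ab]; rewrite inE ab andbT /= => /orP[] h.
  exact: Scl h.
by apply: Scl (Scl _ _ xS h) _; rewrite adj_sym.
Qed.

Lemma S_clo_bounds : [/\ 0 < t, t <= #|S| & t < #|H|].
Proof.
have Scl := component_is_closed SH.
have [x xS] := component_neq0 SH.
have /card_gt0P[y] : 0 < #|nbrs x| by apply: leq_trans (degS xS).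
rewrite inE => xy; rewrite -(cloS xS xy); split.
- by apply/card_gt0P; exists x; rewrite inE xy orbT.
- apply/subset_leq_card/subsetP=> z; rewrite inE => /orP[] h.
    by apply: Scl xS _; rewrite adj_sym.
  by apply: Scl (Scl _ _ xS xy) _; rewrite adj_sym.
- by rewrite -[X in _ < X](cardsC (clo x y)) -[X in X < _]addn0 ltn_add2l clo_proper.
Qed.

Local Open Scope ring_scope.

Lemma S_load x : x \in S -> load x = (m * 2)%:R / (#|H| - t)%:R.
Proof.
have Scl := component_is_closed SH.
move=> xS; rewrite mulr_natl -(arcsS xS) -sumr_const; apply: eq_bigr => -[a b].
rewrite inE /= => /andP[ab xab]; rewrite /weight /=; congr (_%:R^-1).
rewrite -[#|H|](cardsC (clo a b)) (@cloS a b) ?addKn //.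
move: xab; rewrite inE => /orP[] h; first exact: Scl h.
by apply: Scl (Scl _ _ xS h) _; rewrite adj_sym.
Qed.

Local Open Scope nat_scope.

(** If they met, [S] would be the star itself, whose center has a neighbour of degree 1, contrary to
    [degS]. *)
Lemma center_disjoint (v : H) : center v -> [disjoint v |: nbrs v & S].
Proof.
move=> vc; apply/pred0Pn => -[x /= /andP[xv xS]].
have SE := component_star SH vc xS xv.
have vS : v \in S by rewrite SE setU11.
have /card_gt0P[z] : 0 < #|nbrs v| by apply: leq_trans (degS vS).
move=> zv; have : z \in S by rewrite SE inE zv orbT.
by move/degS; rewrite vc ?cards1 //; rewrite inE in zv.
Qed.

Lemma center_load (v : H) : center v ->
  #|nbrs v| * (#|H| - t) = m * (#|H| - #|nbrs v|.+1).
Proof.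
move=> vc; have [x xS] := component_neq0 SH; have [_ _ tH] := S_clo_bounds.
(* [S] is nonempty and avoids the star, so the denominator in [star_load] is nonzero. *)
have lH : #|nbrs v|.+1 < #|H|.
  rewrite -card_star -(cardsC (v |: nbrs v)) -[X in X < _]addn0 ltn_add2l.
  apply/card_gt0P; exists x; rewrite inE.
  by have /pred0P/(_ x) := center_disjoint vc; rewrite /= xS andbT => ->.
have := load_const v x; rewrite star_load // S_load // => /eqP.
rewrite eqr_div ?pnatr_eq0 -?lt0n ?subn_gt0 // -!natrM eqr_nat => /eqP.
rewrite mulnC; nia.
Qed.

(** In the equation of [center_load] the left side strictly increases with the degree and the right
    side never increases, so the solution is unique. *)
Lemma center_degree (v w : H) : center v -> center w -> #|nbrs v| = #|nbrs w|.
Proof.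
have [x xS] := component_neq0 SH; have [t0 _ tH] := S_clo_bounds.
move=> /center_load hv /center_load hw; nia.
Qed.

(** Components split into stars, [S] and the rest. The degree sum of a star is 2 short of twice its
    order, while the rest are never short, so [few_edges] leaves [S] a degree sum below
    [2 * #|S| + 2 * s]. *)
Lemma uniform_component_absurd : False.
Proof.
have [u0 /(low_degree_center clo_proper load_const) [v0 v0c _]] := exists_low_degree.
(* By [low_degree_center], one vertex of degree at most 1 makes its component a star. *)
pose isstar (A : {set H}) := [exists u : H, (u \in A) && (#|nbrs u| <= 1)].
pose l := #|nbrs v0|.
pose P := components H.
have starP A : A \in P -> isstar A ->
    #|A| = l.+1 /\ \sum_(v in A) #|nbrs v| = 2 * l.
  move=> AP /existsP[u /andP[uA /(low_degree_center clo_proper load_const)[v vc uv]]].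
  rewrite (component_star AP vc uA uv) card_star star_sum_deg //.
  by rewrite (center_degree vc v0c).
have nstarP A : ~~ isstar A -> 2 * #|A| <= \sum_(v in A) #|nbrs v|.
  move=> nA; rewrite mulnC -sum_nat_const leq_sum // => v vA.
  by rewrite ltnNge; apply: contra nA => h; apply/existsP; exists v; rewrite vA.
have nS : ~~ isstar S.
  by apply/negP => /existsP[u /andP[/degS]]; rewrite ltnNge => /negPf ->.
pose s := #|[set A in P | isstar A]|.
have parH := components_partition H.
have nH : #|H| = l.+1 * s + (#|S| + \sum_(A in P | ~~ isstar A && (A != S)) #|A|).
  rewrite -cardsT (card_partition parH) (bigID isstar) /= [X in _ + X](bigD1 S) /=; last by apply/andP.
  congr (_ + (_ + _)); last by apply: eq_bigl => A; rewrite andbA.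
  rewrite mulnC -sum_nat_const; apply: eq_big => [A|A]; first by rewrite inE.
  by case/andP => AP /(starP _ AP) [].
have dH : \sum_(v : H) #|nbrs v| = 2 * l * s + (\sum_(v in S) #|nbrs v| +
    \sum_(A in P | ~~ isstar A && (A != S)) \sum_(v in A) #|nbrs v|).
  transitivity (\sum_(v in [set: H]) #|nbrs v|).
    by apply: eq_bigl => v; rewrite inE.
  rewrite (set_partition_big _ parH) /= (bigID isstar) /= [X in _ + X](bigD1 S) /=; last by apply/andP.
  congr (_ + (_ + _)); last by apply: eq_bigl => A; rewrite andbA.
  rewrite mulnC -sum_nat_const; apply: eq_big => [A|A]; first by rewrite inE.
  by case/andP => AP /(starP _ AP) [].
have rest : 2 * \sum_(A in P | ~~ isstar A && (A != S)) #|A| <=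
    \sum_(A in P | ~~ isstar A && (A != S)) \sum_(v in A) #|nbrs v|.
  by rewrite big_distrr leq_sum // => A /and3P[_ h _]; exact: nstarP.
have [t0 tS tH] := S_clo_bounds.
apply: (@component_arith #|H| #|S| (\sum_(v in S) #|nbrs v|) s l m t) => //.
- exact: S_degree_sum.
- exact: S_double_count.
- by move: few_edges; rewrite dH {1}nH; clear -rest; nia.
- by rewrite [X in _ <= X]nH addnA leq_addr.
- exact: center_load.
Qed.

End UniformComponent.

(** * From betweenness in [G] to closeness in its complement *)

Section CoBUG.
Variable G : sgraph.
Hypothesis Gconn : connected G.
Hypothesis low : forall x : G, (betweenness x < 1)%R.
Let H := complement G.

(** Away from [v] and [w], nonadjacency in the complement is adjacency in [G]; the ends themselves
    are close to the edge and are not common neighbours. *)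
Lemma common_clo (v w : H) : adj v w -> @common G v w = ~: clo v w.
Proof.
case/andP=> vw nvw; apply/setP => x; rewrite !inE /= /co_adj negb_or !negb_and !negbK.
case: (x =P v) => [->|_] /=.
  by rewrite adj_irrefl (negPf vw) (negPf nvw).
by case: (x =P w) => [->|] //=; rewrite adj_sym (negPf nvw).
Qed.

Lemma coBUG_clo_proper (v w : H) : adj v w -> 0 < #|~: clo v w|.
Proof. by move=> vw; rewrite -common_clo // card_gt0; exact: (common_neq0 Gconn low). Qed.

(** Each arc of the complement contributes at least 1 to the excess. *)
Lemma coBUG_few_edges : \sum_(v : H) #|nbrs v| < 2 * #|H|.
Proof.
apply: leq_ltn_trans (sum_excess Gconn low); apply: leq_sum => v _.
rewrite -sum1dep_card big_mkcond; apply: leq_sum => w _.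
by case: ifP => // vw; rewrite /excess (vw : @co_adj G v w).
Qed.

(** The arcs not close to [x] carry twice its betweenness, so equal betweenness gives equal load. *)
Lemma coBUG_load (x : H) :
  (load x = \sum_(p : H * H | adj p.1 p.2) weight p - betweenness (x : G) *+ 2)%R.
Proof.
rewrite (double_betweenness Gconn low) pair_big_dep /=; apply/eqP; rewrite eq_sym subr_eq; apply/eqP.
rewrite (bigID (fun p : H * H => x \in clo p.1 p.2)) /=; congr (_ + _)%R.
  by apply: eq_bigl => p; rewrite [RHS]inE.
apply: eq_big => [p|p /andP[pe _]]; last by rewrite /weight common_clo.
by apply: andb_id2l => pe; rewrite (common_clo pe) [RHS]inE.
Qed.

End CoBUG.

Theorem theorem17 (coG : sgraph) (hcoG : exotic_coBUG coG)
    (S : {set coG}) (hS : S \in components coG) (hU : uniform (induced S)) :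
  exists l : nat, iso (induced S) (star l).
Proof.
case: hcoG => G [[[Gconn unif] low] _] E; subst coG.
have clop := coBUG_clo_proper Gconn low.
have load_const (x y : complement G) : load x = load y.
  by rewrite !(coBUG_load Gconn low) (unif x y).
(* Either a vertex of degree at most 1 exhibits the star, or all degrees in [S] are at least 2,
   which uniformity rules out. *)
case: (boolP [exists u : complement G, (u \in S) && (#|nbrs u| <= 1)]).
  case/existsP=> u /andP[uS /(low_degree_center clop load_const)[v vc uv]].
  by exists #|nbrs v|; rewrite (component_star hS vc uS uv); apply: star_iso.
rewrite negb_exists => /forallP deg.
have [m [t [arcsS cloS]]] := uniform_component (component_is_closed hS) hU.
case: (uniform_component_absurd clop load_const (coBUG_few_edges Gconn low) hS arcsS cloS).
by move=> x xS; have := deg x; rewrite xS ltnNge.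
Qed.
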